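(* Let $(X,\tau,g)$ be a $\Sigma_g$-semicomplete space. Let the function $f:X\to\mathbb{R}\cup\{+\infty\}$ be proper, lower semicontinuous and bounded below. Suppose that for each $x\in X$ with $f(x)>\inf_X f$ there exists $y\in X$, $y\neq x$, such that $$g(y,x)\le f(x)-f(y).$$ Then there exists $v\in X$ such that $f(v)=\inf_X f$.
   Context: $\mathbb{R}^+=[0,\infty)$. A premetric space $(X,\tau,g)$ is a first countable topological space $(X,\tau)$ with a premetric function $g:X\times X\to\mathbb{R}^+$, i.e. (P1) $g(x,x)=0$ for all $x\in X$ and $g(x,y)>0$ whenever $x\neq y$; (P2) $g(x,\cdot)$ is continuous for every fixed $x\in X$. (No symmetry or triangle inequality is assumed.) A sequence $\{x_n\}_{n\ge0}$ in $X$ is $\Sigma_g$-Cauchy if its $g$-length $\sum_{i=0}^\infty g(x_{i+1},x_i)$ is finite. $(X,\tau,g)$ is called $\Sigma_g$-semicomplete if it is a first countable premetric space in which every $\Sigma_g$-Cauchy sequence has a convergent subsequence. Proper means $f$ is not identically $+\infty$. If $f(x)=+\infty$ and $f(y)<+\infty$, then $f(x)-f(y)=+\infty$. *)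

(* Defs.v *)
From HB Require Import structures.
From mathcomp Require Import all_boot all_order all_algebra.
From mathcomp Require Import all_classical all_reals all_analysis.

Set Implicit Arguments.
Unset Strict Implicit.
Unset Printing Implicit Defensive.

Import Order.TTheory GRing.Theory Num.Theory.
Import numFieldNormedType.Exports.

Local Open Scope classical_set_scope.
Local Open Scope ring_scope.

Definition first_countable (X : topologicalType) : Prop :=
  forall x : X, exists B : set (set X),
    [/\ countable B,
        forall V, B V -> nbhs x V
      & forall U, nbhs x U -> exists2 V, B V & V `<=` U].

(* Neither symmetry nor the triangle inequality is required. *)
Record premetric (R : realType) (X : topologicalType) (g : X -> X -> R) : Prop :=
  Premetric {
    premetric_ge0 : forall x y, 0 <= g x y ;
    premetric_xx : forall x, g x x = 0 ;
    premetric_gt0 : forall x y, x != y -> 0 < g x y ;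
    premetric_continuous : forall x, continuous (g x) }.

Record premetric_space (R : realType) (X : topologicalType) (g : X -> X -> R)
    : Prop := PremetricSpace {
  premetric_space_first_countable : first_countable X ;
  premetric_space_premetric : premetric g }.

(* The later point of the sequence is the first argument of g. *)
Definition g_length (R : realType) (X : topologicalType) (g : X -> X -> R)
    (x : nat -> X) : \bar R :=
  (\sum_(0 <= i <oo) (g (x i.+1) (x i))%:E)%E.

Definition sigma_cauchy (R : realType) (X : topologicalType) (g : X -> X -> R)
    (x : nat -> X) : Prop :=
  (g_length g x < +oo)%E.

Definition has_cvg_subsequence (X : topologicalType) (x : nat -> X) : Prop :=
  exists (phi : nat -> nat) (l : X),
    increasing_seq phi /\ (x \o phi) n @[n --> \oo] --> l.

Record sigma_semicomplete (R : realType) (X : topologicalType)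
    (g : X -> X -> R) : Prop := SigmaSemicomplete {
  sigma_semicomplete_space : premetric_space g ;
  sigma_semicomplete_cvg :
    forall x : nat -> X, sigma_cauchy g x -> has_cvg_subsequence x }.

(* A function X -> \bar R whose values avoid -oo stands for a function into
   R `|` {+oo}. *)
Definition proper_function (R : realType) (X : Type) (f : X -> \bar R) : Prop :=
  exists x, f x != +oo%E.

Definition bounded_below (R : realType) (X : Type) (f : X -> \bar R) : Prop :=
  exists m : R, forall x, (m%:E <= f x)%E.

(* Main.v *)
Require Import Defs.
From HB Require Import structures.
From mathcomp Require Import all_boot all_order all_algebra.
From mathcomp Require Import all_classical all_reals all_analysis.
From mathcomp Require Import lra.
Import Order.TTheory GRing.Theory Num.Theory.
Import numFieldNormedType.Exports.
Local Open Scope classical_set_scope.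
Local Open Scope ring_scope.

(** Suppose that the infimum is not attained, and call [y] reachable from [x]
    when [g y x < 2 (f x - f y)] with both values finite.  The factor [2] makes
    the hypothesis on [f] give a strict inequality, so that by continuity of
    [g w], a point [w] reachable from a limit [v] of a sequence with values
    [f >= f v] is reachable from the terms close to [v].  Build a sequence in
    which every step realizes at least half of the decrease of [f] available
    among the reachable points.  Its length telescopes, so a subsequence
    converges to some [v], and by semicontinuity [f v] is a lower bound of [f]
    along the sequence.  A point [w] reachable from [v] has [f w < f v] and is
    reachable from infinitely many terms, whose successors therefore descend
    halfway to [f w], and eventually below [f v]. *)

(** Since [inf A < c], the midpoint of [c] and [inf A] exceeds [inf A], so some element of [A] lies
    below it. *)
Lemma exists_halfway_to_inf (R : realType) (A : set R) (c : R) :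
  A !=set0 -> has_lbound A -> (forall a, A a -> a < c) ->
  exists2 a, A a & forall b, A b -> a <= (c + b) / 2.
Proof.
move=> A0 Alb Ac.
have infc : inf A < c.
  by have [a Aa] := A0; apply: le_lt_trans (Ac _ Aa); exact: ge_inf.
have [a Aa alt] : exists2 a, A a & a < inf A + (c - inf A) / 2.
  by apply: inf_adherent => //; rewrite divr_gt0 // subr_gt0.
exists a => // b Ab.
have : inf A <= b by exact: ge_inf.
lra.
Qed.

Lemma sigma_cauchy_telescope (R : realType) (X : topologicalType)
    (g : X -> X -> R) (x : nat -> X) (u : nat -> R) (m : R) :
  (forall y z, 0 <= g y z) -> (forall i, m <= u i) ->
  (forall i, g (x i.+1) (x i) <= u i - u i.+1) ->
  sigma_cauchy g x.
Proof.
move=> g0 mu gu; rewrite /sigma_cauchy /g_length.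
apply: (@le_lt_trans _ _ (u 0%N - m)%:E); last exact: ltry.
apply: lime_le; first by apply: is_cvg_nneseries => i _ _; rewrite lee_fin.
near=> n; rewrite sumEFin lee_fin.
apply: (@le_trans _ _ (\sum_(0 <= i < n) (u i - u i.+1))).
  by apply: ler_sum => i _.
rewrite (telescope_sumr_eq (fun i => - u i)) //; last by move=> i _; lra.
have := mu n; lra.
Unshelve. all: by end_near.
Qed.

Lemma lower_semicontinuous_le_limit (R : realType) (X : topologicalType)
    (f : X -> \bar R) (y : nat -> X) (v : X) (a : R) :
  lower_semicontinuous f -> y n @[n --> \oo] --> v ->
  (\forall n \near \oo, (f (y n) <= a%:E)%E) -> (f v <= a%:E)%E.
Proof.
move=> flsc yv fya; rewrite leNgt; apply/negP => /flsc[V Vv aV].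
near \oo => n.
have /aV : V (y n) by near: n; exact: yv.
by rewrite ltNge => /negP; apply; near: n.
Unshelve. all: by end_near.
Qed.

(* In \bar R, (+oo) - r = +oo for r finite, while (+oo) - (+oo) = -oo, so the
   inequality below forces f y < +oo. *)
Theorem theorem3p7 (R : realType) (X : topologicalType) (g : X -> X -> R)
    (f : X -> \bar R)
    (Xsc : sigma_semicomplete g)
    (f_ninfty : forall x, f x != -oo%E)
    (f_proper : proper_function f)
    (f_lsc : lower_semicontinuous f)
    (f_bounded : bounded_below f)
    (f_step : forall x : X, (ereal_inf (range f) < f x)%E ->
      exists2 y : X, y != x & ((g y x)%:E <= f x - f y)%E) :
  exists v : X, f v = ereal_inf (range f).
Proof.
have [[_ [g0 _ gpos gcont]] gsub] := Xsc.
have [x0 fx0] := f_proper; have [m fm] := f_bounded.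
apply: contrapT => noinf.
(* [fine] sends [+oo] to 0, so [h] is meaningful only where [f] is finite. *)
pose h x := fine (f x).
have hE x : f x != +oo%E -> f x = (h x)%:E.
  by move=> fx; rewrite /h fineK // fin_numE f_ninfty.
have hm x : f x != +oo%E -> m <= h x by move=> fx; rewrite -lee_fin -hE.
pose reach x y := f y != +oo%E /\ g y x < 2 * (h x - h y).
have reach_lt x y : reach x y -> h y < h x.
  by case=> _; have := g0 y x; lra.
have reach_ex x : f x != +oo%E -> exists y, reach x y.
  move=> fx; have [|y yx gyx] := f_step x.
    rewrite lt_neqAle ereal_inf_lbound ?andbT; last by exists x.
    by apply/eqP => fxE; apply: noinf; exists x.
  have fy : f y != +oo%E.
    by apply: contraTneq gyx => ->; rewrite hE.
  exists y; split=> //; have := gpos _ _ yx.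
  move: gyx; rewrite (hE _ fx) (hE _ fy) -EFinB lee_fin; lra.
have next_ex x : exists y, f x != +oo%E ->
    reach x y /\ forall z, reach x z -> h y <= (h x + h z) / 2.
  have [fx|] := pselect (f x != +oo%E); last by exists x.
  have [|||_ [y xy <-] yhalf] :=
      @exists_halfway_to_inf _ (h @` [set y | reach x y]) (h x).
  - by have [y xy] := reach_ex _ fx; exists (h y), y.
  - by exists m => _ [y [fy _] <-]; exact: hm.
  - by move=> _ [y xy <-]; exact: reach_lt.
  by exists y => _; split=> // z xz; apply: yhalf; exists z.
have [s sP] := choice next_ex.
pose x n := iter n s x0.
have fx n : f (x n) != +oo%E.
  by elim: n => // n /sP[[]].
have xreach n : reach (x n) (x n.+1) by have [] := sP _ (fx n).
have xhalf n z : reach (x n) z -> h (x n.+1) <= (h (x n) + h z) / 2.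
  by have [_] := sP _ (fx n); exact.
have hx_dec i j : (i <= j)%N -> h (x j) <= h (x i).
  by apply: (nonincreasing_seqP (h \o x)).1 => n; exact/ltW/reach_lt.
have xcauchy : sigma_cauchy g x.
  apply: (@sigma_cauchy_telescope _ _ _ _ (fun n => 2 * h (x n)) (2 * m)) => //.
    by move=> i; rewrite ler_pM2l // hm.
  by move=> i; have [_] := xreach i; lra.
have [phi [v [phi_inc xv]]] := gsub _ xcauchy.
(* [increasing_seq] is an equivalence of inequalities, so [phi] is strictly increasing. *)
have phi_ge n k : (n <= k)%N -> (n <= phi k)%N.
  elim: n k => // n IHn [//|k] nk; apply: leq_ltn_trans (IHn k nk) _.
  by rewrite ltnNge [(_ <= _)%N]phi_inc -ltnNge.
have fv n : (f v <= (h (x n))%:E)%E.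
  apply: lower_semicontinuous_le_limit f_lsc xv _.
  near=> k; rewrite /= hE // lee_fin hx_dec // phi_ge //.
  by near: k; exact: nbhs_infty_ge.
have fvoo : f v != +oo%E by rewrite lt_eqF // (le_lt_trans (fv 0%N)) // ltry.
have hv n : h v <= h (x n) by rewrite -lee_fin -hE.
have [w vw] := reach_ex _ fvoo.
have hwv := reach_lt _ _ vw; have [fw gwv] := vw.
pose L := inf (range (h \o x)).
have Llb : has_lbound (range (h \o x)).
  by exists (h v) => _ [n _ <-]; exact: hv.
have vL : h v <= L.
  by apply: lb_le_inf; [exists (h (x 0%N)), 0%N | move=> _ [n _ <-]; exact: hv].
(* This bound puts the midpoint of [h (x n)] and [h w] below [L]. *)
have [_ [n _ <-] xnL] : exists2 a, range (h \o x) a & a < L + (L - h w).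
  apply: inf_adherent; last by split=> //; exists (h (x 0%N)), 0%N.
  by rewrite subr_gt0; exact: lt_le_trans vL.
near \oo => k.
have xw : reach (x (phi k)) w.
  split=> //.
  (* As [h v <= h (x (phi k))], it suffices to carry the strict bound on [g w v] over to nearby
     points. *)
  apply: (@lt_le_trans _ _ (2 * (h v - h w))); last first.
    by rewrite ler_pM2l // lerD2r.
  near: k; apply: (cvgr_lt (g w v)) => //.
  exact: (cvg_comp _ _ xv (gcont w v)).
have xkn : h (x (phi k)) <= h (x n).
  by rewrite hx_dec // phi_ge //; near: k; exact: nbhs_infty_ge.
have Lx : L <= h (x (phi k).+1) by apply: ge_inf => //; exists (phi k).+1.
have := xhalf _ _ xw; move: xnL => /=; lra.
Unshelve. all: by end_near.
Qed.
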